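(* Let $G$ be a graph (multiple edges allowed, no loops) obtained from a bipartite graph by adding one edge. Then $L(G)$ has a proper Galvin orientation with respect to $\chi'(G)$. The same conclusion holds if, instead of a single edge, a multi-edge (a set of parallel edges between the same two vertices) is added to a bipartite graph, provided its multiplicity is at most $\lfloor\tfrac{\chi'(G)+1}{2}\rfloor$.
   Context: Graphs may have multiple edges but no loops. $\chi'(G)$ is the chromatic index of $G$. A $k$-edge-colouring is an assignment of colours from $\{1,\dots,k\}$ to edges so that adjacent edges get different colours. The line graph $L(G)$ has vertex set $E(G)$, and two edges $e,f$ of $G$ are joined in $L(G)$ by as many edges as the number of ends they share in $G$ (2 if parallel, 1 if adjacent but not parallel, 0 otherwise); thus each edge of $L(G)$ corresponds to a common incidence of its two ends at a vertex of $G$. Given a partition of $V(G)$ into sets $U$ and $D$ and a $k$-edge-colouring $\varphi$ of $G$, the Galvin orientation of $L(G)$ (with respect to $U,D,\varphi$) is defined as follows: for an edge of $L(G)$ with ends $e_1,e_2$, where $\varphi(e_1)<\varphi(e_2)$, corresponding to a common incidence at a vertex $x$ of $G$: if $x\in D$ it is oriented from $e_2$ to $e_1$, and if $x\in U$ it is oriented from $e_1$ to $e_2$. A kernel of a digraph is an independent set $K$ such that every vertex outside $K$ has an out-edge into $K$; a digraph is kernel-perfect if every induced subdigraph has a kernel. A Galvin orientation with respect to $U,D$ and a $k$-edge-colouring is proper if it is kernel-perfect and every vertex has outdegree at most $k-1$. $L(G)$ has a proper Galvin orientation with respect to $k$ if there exist a partition $(U,D)$ of $V(G)$ and a $k$-edge-colouring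 $\varphi$ of $G$ such that the corresponding Galvin orientation is proper. *)

(* Defs.v *)
From mathcomp Require Import all_boot.

Set Implicit Arguments.
Unset Strict Implicit.
Unset Printing Implicit Defensive.

(* Finite loopless multigraphs: parallel edges are distinct elements of [edge]
   with the same set of ends. *)
Record multigraph := Multigraph {
  vert : finType;
  edge : finType;
  ends : edge -> {set vert};
  card_ends : forall e, #|ends e| = 2
}.

Definition bipartite (G : multigraph) : Prop :=
  exists A : {set vert G}, forall e : edge G, #|ends e :&: A| = 1.

Lemma del_edges_subproof (G : multigraph) (M : {set edge G})
  (e : {e : edge G | e \notin M}) : #|ends (val e)| = 2.
Proof. exact: card_ends. Qed.

(* G is obtained from [del_edges M] by adding the edges in M. *)
Definition del_edges (G : multigraph) (M : {set edge G}) : multigraph :=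
  @Multigraph (vert G) {e : edge G | e \notin M} (fun e => ends (val e))
    (@del_edges_subproof G M).

Definition multi_edge (G : multigraph) (M : {set edge G}) : Prop :=
  M != set0 /\ {in M &, forall e f, ends e = ends f}.

(* Colour i : 'I_k stands for the colour i + 1 of {1, ..., k}; only the order
   of the colours is ever used. *)
Definition edge_colouring (G : multigraph) k (phi : {ffun edge G -> 'I_k}) :=
  [forall e : edge G, forall f : edge G,
     (e != f) && (ends e :&: ends f != set0) ==> (phi e != phi f)].

Definition edge_colourable (G : multigraph) (k : nat) : bool :=
  [exists phi : {ffun edge G -> 'I_k}, edge_colouring phi].

Lemma edge_colourable_ex (G : multigraph) : exists k, edge_colourable G k.
Proof.
exists #|edge G|; apply/existsP; exists [ffun e => enum_rank e].
apply/'forall_forallP => e f; apply/implyP => /andP[nef _].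
by rewrite !ffunE (inj_eq enum_rank_inj).
Qed.

Definition chromatic_index (G : multigraph) : nat :=
  ex_minn (edge_colourable_ex G).

(* The edges of L(G) are the pairs ({e, f}, x) with e != f and x a common end of
   e and f in G. *)
Definition incidence (G : multigraph) : finType :=
  {p : {set edge G} * vert G |
     (#|p.1| == 2) && [forall e in p.1, p.2 \in ends e]}.

Lemma line_graph_subproof (G : multigraph) (a : incidence G) : #|(val a).1| = 2.
Proof. by case/andP: (valP a) => /eqP. Qed.

Definition line_graph (G : multigraph) : multigraph :=
  @Multigraph (edge G) (incidence G) (fun a => (val a).1)
    (@line_graph_subproof G).

Definition incidence_vertex (G : multigraph) (a : edge (line_graph G)) :
  vert G := (val a).2.

Record orientation (G : multigraph) := Orientation {
  arc_tail : edge G -> vert G;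
  arc_head : edge G -> vert G;
  orientation_ends : forall a, ends a = [set arc_tail a; arc_head a]
}.

Section Digraphs.
Variables (G : multigraph) (O : orientation G).
Implicit Types S K : {set vert G}.

(* K is a kernel of the subdigraph of O induced by S. *)
Definition kernel_of_induced S K : Prop :=
  [/\ K \subset S,
      forall a : edge G, ~ (arc_tail O a \in K /\ arc_head O a \in K) &
      forall v, v \in S -> v \notin K ->
        exists a : edge G, arc_tail O a = v /\ arc_head O a \in K].

Definition kernel_perfect : Prop := forall S, exists K, kernel_of_induced S K.

Definition outdegree (v : vert G) : nat := #|[set a | arc_tail O a == v]|.

End Digraphs.

(* O is the Galvin orientation of L(G) with respect to U, D and phi; existence and
   uniqueness are [Galvin_exists] and [Galvin_unique]. *)
Definition Galvin (G : multigraph) (U D : {set vert G}) k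
    (phi : {ffun edge G -> 'I_k}) (O : orientation (line_graph G)) : Prop :=
  forall (a : edge (line_graph G)) (e1 e2 : edge G),
    ends a = [set e1; e2] -> phi e1 < phi e2 ->
    (incidence_vertex a \in D -> arc_tail O a = e2 /\ arc_head O a = e1) /\
    (incidence_vertex a \in U -> arc_tail O a = e1 /\ arc_head O a = e2).

Definition vertex_partition (G : multigraph) (U D : {set vert G}) : Prop :=
  U :|: D = [set: vert G] /\ U :&: D = set0.

Lemma line_graph_ltP (G : multigraph) k (phi : {ffun edge G -> 'I_k})
    (a : edge (line_graph G)) : edge_colouring phi ->
  exists e1 e2 : edge G, ends a = [set e1; e2] /\ phi e1 < phi e2.
Proof.
move=> /'forall_forallP col.
case/andP: (valP a) => /cards2P[e [f [nef def_a]]] /forall_inP xP.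
have [xe xf] : (val a).2 \in ends e /\ (val a).2 \in ends f.
  by split; apply: xP; rewrite def_a !inE eqxx ?orbT.
have: phi e != phi f.
  apply: (implyP (col e f)); rewrite nef.
  by apply/set0Pn; exists (val a).2; rewrite inE xe.
rewrite -val_eqE neq_ltn => /orP[lt|lt]; [exists e, f | exists f, e]; split=> //.
by rewrite [RHS]setUC.
Qed.

Lemma Galvin_exists (G : multigraph) (U D : {set vert G}) k
    (phi : {ffun edge G -> 'I_k}) :
  vertex_partition U D -> edge_colouring phi -> exists O, Galvin U D phi O.
Proof.
move=> [_ UD0] col.
have sel (a : edge (line_graph G)) : exists p : edge G * edge G,
    (ends a == [set p.1; p.2]) && (phi p.1 < phi p.2).
  by have [e1 [e2 [-> lt]]] := line_graph_ltP a col; exists (e1, e2); rewrite eqxx.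
pose p a := xchoose (sel a); pose inD a := incidence_vertex a \in D.
have pP a : ends a = [set (p a).1; (p a).2] /\ phi (p a).1 < phi (p a).2.
  by case/andP: (xchooseP (sel a)) => /eqP.
have endsP a : ends a = [set if inD a then (p a).2 else (p a).1;
                             if inD a then (p a).1 else (p a).2].
  by case: ifP => _; rewrite (pP a).1 // [LHS]setUC.
exists (@Orientation (line_graph G) _ _ endsP) => a e1 e2 def_a lt12 /=.
have [def_p ltp] := pP a.
have [-> ->] : e1 = (p a).1 /\ e2 = (p a).2.
  have: (e1 \in ends a) && (e2 \in ends a) by rewrite def_a !inE !eqxx orbT.
  rewrite def_p !inE => /andP[/orP[]/eqP E1 /orP[]/eqP E2] //.
  - by move: lt12; rewrite E1 E2 ltnn.
  - by move: lt12; rewrite E1 E2 ltnNge (ltnW ltp).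
  - by move: lt12; rewrite E1 E2 ltnn.
rewrite /inD; split=> [->|xU] //; case: ifP => // xD.
by have := in_set0 (incidence_vertex a); rewrite -UD0 inE xU xD.
Qed.

Lemma Galvin_unique (G : multigraph) (U D : {set vert G}) k
    (phi : {ffun edge G -> 'I_k}) (O O' : orientation (line_graph G)) :
  vertex_partition U D -> edge_colouring phi ->
  Galvin U D phi O -> Galvin U D phi O' ->
  forall a, arc_tail O a = arc_tail O' a /\ arc_head O a = arc_head O' a.
Proof.
move=> [UDT _] col GO GO' a; have [e1 [e2 [def_a lt]]] := line_graph_ltP a col.
have [OD OU] := GO a _ _ def_a lt; have [OD' OU'] := GO' a _ _ def_a lt.
have := in_setT (incidence_vertex a); rewrite -UDT inE.
by case/orP=> [/[dup] /OU[-> ->] /OU'[-> ->] | /[dup] /OD[-> ->] /OD'[-> ->]].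
Qed.

Definition proper_orientation (G : multigraph) k
    (O : orientation (line_graph G)) : Prop :=
  kernel_perfect O /\ forall e, outdegree O e <= k - 1.

Definition has_proper_Galvin_orientation (G : multigraph) (k : nat) : Prop :=
  exists (U D : {set vert G}) (phi : {ffun edge G -> 'I_k})
         (O : orientation (line_graph G)),
    [/\ vertex_partition U D, edge_colouring phi, Galvin U D phi O
      & proper_orientation k O].

(* Main.v *)
(* If the two ends of the added multi-edge M lie on different sides, then G is
   bipartite and M may be taken empty. Otherwise let U be the side containing both
   ends of M, and permute the colours so that M gets the |M| largest ones. An edge
   with colour i (counted from 0) has at most i out-neighbours at an end in D and at
   most k - 1 - i at an end in U; this gives k - 1 for an edge between U and D, and
   2(|M| - 1) <= k - 1 for an edge in M. As for kernels of the subdigraph induced by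
   S, the edge of S :&: M with the largest colour is a sink that absorbs all its
   neighbours in S; what remains of S joins U to D, and Galvin's argument applies. *)
Require Import Defs.
From mathcomp Require Import all_boot zify.

Set Implicit Arguments.
Unset Strict Implicit.
Unset Printing Implicit Defensive.

(** * Stable kernels of edge sets crossing between [U] and its complement *)

Section GalvinOrientation.

Variables (G : multigraph) (k : nat) (phi : {ffun edge G -> 'I_k}).
Variable U : {set vert G}.
Hypothesis phi_col : edge_colouring phi.

Implicit Types (e f : edge G) (S K : {set edge G}) (x y : vert G).

Lemma colour_neq e f x : x \in ends e -> x \in ends f -> e != f -> phi e != phi f.
Proof.
move=> xe xf nef; move/'forall_forallP: phi_col => /(_ e f)/implyP; apply.
by rewrite nef; apply/set0Pn; exists x; rewrite inE xe.
Qed.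

(** In the stable-matching reading, the edge that [x] likes better is [f], the last argument. *)
Definition prefers x e f := if x \in U then phi e < phi f else phi f < phi e.

(* The Galvin orientation with parts U and ~: U has an arc from e to f. *)
Definition dominated e f :=
  [exists x, [&& x \in ends e, x \in ends f & prefers x e f]].

Lemma dominatedP e f :
  reflect (exists x, [/\ x \in ends e, x \in ends f & prefers x e f])
          (dominated e f).
Proof. by apply: (iffP existsP) => -[x /and3P]; exists x. Qed.

(** A kernel of the subdigraph of L(G) induced by [S], stated in G itself: independence in L(G)
    becomes being a matching. *)
Definition stable_kernel S K :=
  [/\ K \subset S,
      {in K &, forall e f, e != f -> [disjoint ends e & ends f]} &
      {in S, forall e, e \notin K -> exists2 f, f \in K & dominated e f}].

Lemma crossing_uniqU e x y : #|ends e :&: U| = 1 ->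
  x \in ends e -> y \in ends e -> x \in U -> y \in U -> x = y.
Proof.
move=> /eqP/cards1P[z eU] xe ye xU yU.
have: (x \in ends e :&: U) && (y \in ends e :&: U) by rewrite !inE xe ye xU.
by rewrite eU !inE => /andP[/eqP-> /eqP->].
Qed.

Lemma crossing_uniqD e x y : #|ends e :&: U| = 1 ->
  x \in ends e -> y \in ends e -> x \notin U -> y \notin U -> x = y.
Proof.
move=> eU xe ye xU yU.
have /eqP/cards1P[z eD] : #|ends e :\: U| = 1 by rewrite cardsD card_ends eU.
have: (x \in ends e :\: U) && (y \in ends e :\: U) by rewrite !inE xe ye xU yU.
by rewrite eD !inE => /andP[/eqP-> /eqP->].
Qed.

(* Galvin's argument: if the favourite edges of the vertices in U do not form a
   kernel, two of them meet outside U, and the one with the larger colour there can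
   be removed. *)
Lemma crossing_kernel S :
  {in S, forall e, #|ends e :&: U| = 1} -> exists K, stable_kernel S K.
Proof.
have [n leSn] := ubnP #|S|; elim: n => // n IHn in S leSn * => SU.
(* For a crossing edge, [top] says that it is the favourite in [S] of its unique end in [U]. *)
pose top e := [forall f in S,
  [forall x in U, (x \in ends e) && (x \in ends f) ==> (phi f <= phi e)]].
have topP e f x : top e -> f \in S -> x \in U -> x \in ends e -> x \in ends f ->
    phi f <= phi e.
  move=> /forall_inP te fS xU xe xf; move/(_ f fS)/forall_inP: te.
  by move=> /(_ x xU)/implyP; apply; rewrite xe.
have [/existsP[e /existsP[f /existsP[y]]] | /existsPn no_conflict] :=
  boolP [exists e, exists f, exists y, [&& e \in S, f \in S, top e, phi e < phi f,
    y \notin U, y \in ends e & y \in ends f]].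
  case/and5P=> eS fS te lt_ef /and3P[yU ye yf].
  have [||K [KS Kdisj Kabs]] := IHn (S :\ f).
  - by move: leSn; rewrite (cardsD1 f) fS.
  - by move=> g; rewrite !inE => /andP[_ /SU].
  exists K; split=> // [|g gS gK]; first exact: subset_trans KS (subD1set _ _).
  have [-> | ngf] := eqVneq g f; last by apply: Kabs => //; rewrite !inE ngf.
  have [eK | eK] := boolP (e \in K).
    by exists e => //; apply/dominatedP; exists y; rewrite /prefers (negPf yU).
  (* The edge [h] dominating [e] cannot do so in [U], where [e] is top, so it does so at [y]; there
     [phi h < phi e < phi f], and [h] dominates [f] as well. *)
  have [|h hK /dominatedP[x [xe xh]]] := Kabs e _ eK.
    by rewrite !inE eS andbT; apply: contraTneq lt_ef => ->; rewrite ltnn.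
  rewrite /prefers; case: ifPn => [xU | xU] lt_eh.
    have hS : h \in S by have /setD1P[] := subsetP KS h hK.
    by have := topP _ _ _ te hS xU xe xh; rewrite leqNgt lt_eh.
  have exy := crossing_uniqD (SU e eS) xe ye xU yU; rewrite {}exy in xh.
  exists h => //; apply/dominatedP; exists y; split=> //.
  by rewrite /prefers (negPf yU); apply: ltn_trans lt_ef.
exists [set e in S | top e]; split.
- by apply/subsetP=> e; rewrite inE => /andP[].
- move=> e f; rewrite !inE => /andP[eS te] /andP[fS tf] nef.
  wlog lt_ef : e f eS te fS tf nef / phi e < phi f => [IH|].
    have [|ge_ef] := ltnP (phi e) (phi f); first exact: IH.
    apply/pred0P=> x; apply/negP=> /andP[/= xe xf].
    have /negP[] := colour_neq xe xf nef.
    rewrite -val_eqE eqn_leq /= ge_ef andbT leqNgt; apply/negP=> lt_fe.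
    have := @IH f e; rewrite eq_sym lt_fe => /(_ fS tf eS te nef isT)/pred0P/(_ x).
    by rewrite /= xe xf.
  apply/pred0P=> x; apply/negP=> /andP[/= xe xf]; have [xU | xU] := boolP (x \in U).
    by have := topP _ _ _ te fS xU xe xf; rewrite leqNgt lt_ef.
  have /existsPn/(_ f)/existsPn/(_ x) := no_conflict e.
  by rewrite eS fS te lt_ef xU xe xf.
move=> e eS; rewrite inE eS /= => nte.
have /eqP/cards1P[x eUx] := SU e eS.
have: x \in ends e :&: U by rewrite eUx inE.
rewrite inE => /andP[xe xU].
have eP : (e \in S) && (x \in ends e) by rewrite eS.
(* The favourite edge of [x]; it is top because [x] is its only end in [U]. *)
pose f := [arg max_(f > e | (f \in S) && (x \in ends f)) (phi f : nat)].
have [/andP[fS xf] fmax] : (f \in S) && (x \in ends f) /\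
    forall g, (g \in S) && (x \in ends g) -> phi g <= phi f.
  by rewrite /f; case: arg_maxnP.
have tf : top f.
  apply/forall_inP=> g gS; apply/forall_inP=> y yU; apply/implyP=> /andP[yf yg].
  by apply: fmax; rewrite gS (crossing_uniqU (SU f fS) xf yf).
exists f; first by rewrite inE fS.
apply/dominatedP; exists x; split=> //; rewrite /prefers xU ltn_neqAle fmax // andbT.
have nef : e != f by apply: contraNneq nte => ->.
exact: colour_neq xe xf nef.
Qed.

(** * Stable kernels in the presence of a multi-edge inside [U] *)

Variables (M : {set edge G}).
Hypothesis parM : {in M &, forall e f, ends e = ends f}.
Hypothesis MU : {in M, forall e, ends e \subset U}.
Hypothesis crossM : forall e, e \notin M -> #|ends e :&: U| = 1.
Hypothesis topM : forall e f x,
  e \in M -> f \notin M -> x \in ends e -> x \in ends f -> phi f < phi e.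

Lemma stable_kernel_exists S : exists K, stable_kernel S K.
Proof.
have [SM0 | [e0 e0SM]] := set_0Vmem (S :&: M).
  apply: crossing_kernel => e eS; apply: crossM; apply/negP=> eM.
  by have := in_set0 e; rewrite -SM0 inE eS eM.
pose e := [arg max_(e > e0 in S :&: M) (phi e : nat)].
have [/setIP[eS eM] emax] : e \in S :&: M /\
    forall f, f \in S :&: M -> phi f <= phi e.
  by rewrite /e; case: arg_maxnP.
have abs_e f : f \in S -> f != e -> ~~ [disjoint ends f & ends e] -> dominated f e.
  move=> fS nfe /pred0Pn[x /andP[/= xf xe]]; apply/dominatedP; exists x.
  split=> //; rewrite /prefers (subsetP (MU eM)) //.
  have [fM | fM] := boolP (f \in M); last exact: topM eM fM xe xf.
  rewrite ltn_neqAle emax ?inE ?fS // andbT; exact: colour_neq xf xe nfe.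
(* Edges disjoint from [e] are not parallel to it, hence lie outside [M] and cross; their kernel
   stays a matching when [e] is added. *)
have [|K [KS Kdisj Kabs]] :=
    @crossing_kernel [set f in S | [disjoint ends f & ends e]].
  move=> f; rewrite inE => /andP[_ dfe]; apply: crossM; apply/negP=> fM.
  have := card_ends f; rewrite (parM fM eM) in dfe *.
  by move: dfe; rewrite -setI_eq0 setIid => /eqP->; rewrite cards0.
have Kdisj_e f : f \in K -> f \in S /\ [disjoint ends f & ends e].
  by move/(subsetP KS); rewrite inE => /andP[].
exists (e |: K); split.
- by apply/subsetP=> f /setU1P[-> // | /Kdisj_e[]].
- move=> f g /setU1P[-> | fK] /setU1P[-> | gK]; rewrite ?eqxx //.
  + by move=> _; rewrite disjoint_sym; have [] := Kdisj_e g gK.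
  + by move=> _; have [] := Kdisj_e f fK.
  + exact: Kdisj.
move=> f fS; rewrite !inE negb_or => /andP[nfe fK].
have [dfe | dfe] := boolP [disjoint ends f & ends e].
  have [|g gK dfg] := Kabs f _ fK; first by rewrite inE fS.
  by exists g; rewrite ?inE ?gK ?orbT.
by exists e; rewrite ?inE ?eqxx //; apply: abs_e.
Qed.

(** * Kernels and outdegrees of the Galvin orientation *)

Variable O : orientation (line_graph G).
Hypothesis galvinO : Galvin U (~: U) phi O.

(** Together with [dominated_arc], this identifies [dominated] with the arc relation of [O], so that
    stable kernels are kernels and arcs can be counted by colours. *)
Lemma arcP (a : edge (line_graph G)) (x := incidence_vertex a) :
  [/\ x \in ends (arc_tail O a), x \in ends (arc_head O a),
      arc_tail O a != arc_head O a & prefers x (arc_tail O a) (arc_head O a)].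
Proof.
have def_a := orientation_ends O a.
have /andP[_ /forall_inP aP] := valP a.
have [xt xh] : x \in ends (arc_tail O a) /\ x \in ends (arc_head O a).
  split; apply: aP; rewrite -[_.1]/(ends a) def_a !inE eqxx ?orbT //.
have nth : arc_tail O a != arc_head O a.
  have := card_ends a; rewrite def_a.
  by apply: contra_eq_neq => ->; rewrite setUid cards1.
split=> //; have [e1 [e2 [def12 lt12]]] := line_graph_ltP a phi_col.
have [OD OU] := galvinO def12 lt12; rewrite /prefers.
case: ifPn => xU; first by have [-> ->] := OU xU.
by have [|-> ->] := OD; rewrite ?inE.
Qed.

Lemma dominated_arc e f : dominated e f ->
  exists a, arc_tail O a = e /\ arc_head O a = f.
Proof.
move=> /dominatedP[x [xe xf pr]].
have nef : e != f.
  by apply: contraTneq pr => ->; rewrite /prefers ltnn; case: ifP.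
have aP : (#|[set e; f]| == 2) && [forall g in [set e; f], x \in ends g].
  rewrite cards2 nef; apply/forall_inP => g.
  by rewrite !inE => /orP[] /eqP->.
pose a : edge (line_graph G) := exist _ ([set e; f], x) aP.
exists a; move: pr; rewrite /prefers; case: ifPn => xU lt.
  by have [_] := @galvinO a e f erefl lt; apply.
by have [+ _] := @galvinO a f e (setUC _ _) lt; apply; rewrite inE.
Qed.

Lemma Galvin_kernel_perfect : kernel_perfect O.
Proof.
move=> S; have [K [KS Kdisj Kabs]] := stable_kernel_exists S.
exists K; split=> // [a [tK hK] | e eS eK].
  have [xt xh nth _] := arcP a.
  by have /pred0P/(_ (incidence_vertex a)) := Kdisj _ _ tK hK nth; rewrite /= xt xh.
have [f fK /dominated_arc[a [te hf]]] := Kabs e eS eK.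
by exists a; rewrite hf.
Qed.

(** Edges at [x] have distinct colours, so an arc leaving [e] at [x] is determined by the colour of
    its head, which lies above [phi e] if [x] is in [U] and below it otherwise. *)
Lemma outdegree_at e x :
  #|[set a | (arc_tail O a == e) && (incidence_vertex a == x)]|
    <= if x \in U then k.-1 - phi e else phi e.
Proof.
set A := [set a | _].
pose c (a : edge (line_graph G)) := phi (arc_head O a).
have inj_c : {in A &, injective c}.
  move=> a b; rewrite !inE => /andP[/eqP ta /eqP xa] /andP[/eqP tb /eqP xb] cab.
  have [_ xha _ _] := arcP a; have [_ xhb _ _] := arcP b.
  rewrite xa in xha; rewrite xb in xhb.
  have hab : arc_head O a = arc_head O b.
    by apply/eqP; apply: contraT => /(colour_neq xha xhb)/eqP.
  have eab : ends a = ends b by rewrite !(orientation_ends O) ta hab tb.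
  have xab : incidence_vertex a = incidence_vertex b by rewrite xa xb.
  by apply: val_inj; rewrite [LHS]surjective_pairing [RHS]surjective_pairing; congr pair.
rewrite -(card_in_imset inj_c).
pose B := if x \in U then [set i : 'I_k | phi e < i] else [set i : 'I_k | i < phi e].
apply: (@leq_trans #|B|).
  apply/subset_leq_card/subsetP=> _ /imsetP[a /[!inE] /andP[/eqP ta /eqP xa] ->].
  have [_ _ _] := arcP a; rewrite /prefers xa ta /B; case: ifP => _ //; by rewrite inE.
rewrite /B; case: ifP => _; rewrite cardE -(size_map val).
  rewrite -[leqRHS](size_iota (phi e).+1); apply: uniq_leq_size.
    by rewrite map_inj_uniq ?enum_uniq //; apply: val_inj.
  move=> _ /mapP[i /[!mem_enum] /[!inE] lt ->]; rewrite mem_iota lt /=.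
  by have := ltn_ord i; lia.
rewrite -[leqRHS](size_iota 0); apply: uniq_leq_size.
  by rewrite map_inj_uniq ?enum_uniq //; apply: val_inj.
by move=> _ /mapP[i /[!mem_enum] /[!inE] lt ->]; rewrite mem_iota add0n.
Qed.

Lemma outdegree_sum e :
  outdegree O e <= \sum_(x in ends e) (if x \in U then k.-1 - phi e else phi e).
Proof.
rewrite /outdegree -sum1_card.
rewrite (partition_big (@incidence_vertex G) (mem (ends e))) /=; last first.
  by move=> a; rewrite inE => /eqP <-; have [] := arcP a.
apply: leq_sum => x _; apply: leq_trans (outdegree_at e x).
by rewrite -sum1_card; under eq_bigl do rewrite !inE; under [leqRHS]eq_bigl do rewrite inE.
Qed.

Lemma outdegree_crossing e : #|ends e :&: U| = 1 -> outdegree O e <= k - 1.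
Proof.
move=> eU; apply: leq_trans (outdegree_sum e) _.
rewrite (bigID (mem U)) /=.
under eq_bigr => x /andP[_ ->] do [].
under [X in _ + X]eq_bigr => x /andP[_ /negPf->] do [].
rewrite !sum_nat_const.
have -> : #|[pred x in ends e | x \in U]| = 1.
  by rewrite -eU; apply: eq_card => x; rewrite !inE.
have -> : #|[pred x in ends e | x \notin U]| = 1.
  have <- : #|ends e :\: U| = 1 by rewrite cardsD card_ends eU.
  by apply: eq_card => x; rewrite !inE andbC.
by have := ltn_ord (phi e); lia.
Qed.

Lemma outdegree_inside e :
  ends e \subset U -> outdegree O e <= 2 * (k.-1 - phi e).
Proof.
move=> eU; apply: leq_trans (outdegree_sum e) _.
under eq_bigr => x xe do rewrite (subsetP eU x xe).
by rewrite sum_nat_const card_ends.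
Qed.

End GalvinOrientation.

(** * Permuting the colours so that a given set of them comes last *)

Section TopColours.

Variables (k : nat) (C : {set 'I_k}).

(** The colours outside [C] are listed first, so replacing each colour by its index in this list
    makes those of [C] the largest. *)
Definition top_order := enum (~: C) ++ enum C.

Lemma mem_top_order i : i \in top_order.
Proof. by rewrite mem_cat !mem_enum inE orNb. Qed.

Lemma index_top_order_lt i : index i top_order < k.
Proof.
have sz : size top_order = k by rewrite size_cat -!cardE addnC cardsC card_ord.
by rewrite -[ltnRHS]sz index_mem mem_top_order.
Qed.

Definition to_top i : 'I_k := Ordinal (index_top_order_lt i).

Lemma to_top_inj : injective to_top.
Proof.
move=> i j [] eq_ij.
by rewrite -(nth_index i (mem_top_order i)) eq_ij nth_index ?mem_top_order.
Qed.

Lemma to_top_ge i : i \in C -> k - #|C| <= to_top i.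
Proof.
move=> iC; rewrite /= index_cat mem_enum inE iC /= -cardE [#|~: C|]cardsCs setCK.
by rewrite card_ord leq_addr.
Qed.

Lemma to_top_lt i : i \notin C -> to_top i < k - #|C|.
Proof.
move=> iC; have -> : k - #|C| = #|~: C| by rewrite [RHS]cardsCs setCK card_ord.
by rewrite /= index_cat mem_enum inE iC cardE index_mem mem_enum inE.
Qed.

End TopColours.

(** * Choice of the partition and of the colouring *)

Lemma edge_colouring_comp (G : multigraph) k (phi : {ffun edge G -> 'I_k})
    (s : 'I_k -> 'I_k) :
  injective s -> edge_colouring phi -> edge_colouring [ffun e => s (phi e)].
Proof.
move=> inj_s /'forall_forallP col; apply/'forall_forallP=> e f.
by rewrite !ffunE (inj_eq inj_s).
Qed.

Lemma proper_Galvin_add_inside (G : multigraph) k (U : {set vert G})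
    (M : {set edge G}) :
  edge_colourable G k ->
  {in M &, forall e f, ends e = ends f} -> {in M, forall e, ends e \subset U} ->
  (forall e, e \notin M -> #|ends e :&: U| = 1) -> #|M| <= (k + 1) %/ 2 ->
  has_proper_Galvin_orientation G k.
Proof.
move=> /existsP[psi psi_col] parM MU crossM leM.
pose C := psi @: M; pose phi := [ffun e => to_top C (psi e)].
have phi_col : edge_colouring phi by apply: edge_colouring_comp (@to_top_inj _ C) _.
have part : vertex_partition U (~: U) by rewrite /vertex_partition setUCr setICr.
have [O galvinO] := Galvin_exists part phi_col.
exists U, (~: U), phi, O; split=> //; split.
  apply: (Galvin_kernel_perfect phi_col parM MU crossM _ galvinO).
  move=> e f x eM fM xe xf; rewrite !ffunE.
  apply: leq_trans (to_top_ge (imset_f psi eM)); apply: to_top_lt.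
  (* All edges of [M] pass through [x], so every colour of [C] is already taken at [x] by an edge
     other than [f]. *)
  apply/imsetP=> -[g gM /eqP]; apply/negP; apply: (colour_neq psi_col xf (x := x)).
    by rewrite (parM g e).
  by apply: contraNneq fM => ->.
move=> e; have [eM | eM] := boolP (e \in M); last first.
  exact: (outdegree_crossing phi_col galvinO (crossM e eM)).
apply: leq_trans (outdegree_inside phi_col galvinO (MU e eM)) _.
(* Since [#|C| <= #|M|], the new colour of [e] is at least [k - #|M|], so each end contributes at
   most [#|M| - 1]. *)
have := to_top_ge (imset_f psi eM); rewrite -/C ffunE.
have := leq_imset_card psi M; rewrite -/C.
have := ltn_ord (to_top C (psi e)).
have M_gt0 : 0 < #|M| by apply/card_gt0P; exists e.
by set i := nat_of_ord _; set c := #|C|; lia.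
Qed.

Lemma proper_Galvin_add_multi_edge (G : multigraph) k (M : {set edge G}) :
  edge_colourable G k -> multi_edge M -> bipartite (del_edges M) ->
  #|M| <= (k + 1) %/ 2 -> has_proper_Galvin_orientation G k.
Proof.
move=> colG [/set0Pn[e eM] parM] bip leM.
have [A bipA] : exists A : {set vert G}, forall f, f \notin M -> #|ends f :&: A| = 1.
  by case: bip => A bipA; exists A => f fM; apply: (bipA (exist _ f fM)).
have: #|ends e :&: A| <= 2 by rewrite -(card_ends e) subset_leq_card ?subsetIl.
(* No end of [M] in [A]: take [U] to be the complement of [A]. One end: G is bipartite, and the
   empty set serves as [M]. Two ends: take [U] to be [A]. *)
case cardA: #|ends e :&: A| => [|[|[|//]]] _.
- have cardC f : #|ends f :&: ~: A| = 2 - #|ends f :&: A|.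
    by rewrite -setDE cardsD card_ends.
  apply: (proper_Galvin_add_inside (U := ~: A) colG parM) => // f fM.
    rewrite (parM f e) //.
    by rewrite -[ends e]setIT -(setUCr A) setIUr (cards0_eq cardA) set0U subsetIr.
  by rewrite cardC bipA.
- apply: (proper_Galvin_add_inside (U := A) (M := set0) colG);
    try by move=> f; rewrite ?inE.
    move=> f _; have [fM | /bipA//] := boolP (f \in M).
    by rewrite (parM f e).
  by rewrite cards0.
apply: (proper_Galvin_add_inside (U := A) colG parM) => // f fM.
rewrite (parM f e) //; apply/setIidPl/eqP.
by rewrite eqEcard subsetIl cardA card_ends.
Qed.

Theorem theorem3 (G : multigraph) :
  (forall e : edge G, bipartite (del_edges [set e]) ->
     has_proper_Galvin_orientation G (chromatic_index G)) /\
  (forall M : {set edge G}, multi_edge M -> bipartite (del_edges M) ->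
     #|M| <= (chromatic_index G + 1) %/ 2 ->
     has_proper_Galvin_orientation G (chromatic_index G)).
Proof.
have colG : edge_colourable G (chromatic_index G).
  by rewrite /chromatic_index; case: ex_minnP.
split=> [e bip | M]; last exact: proper_Galvin_add_multi_edge colG.
apply: (proper_Galvin_add_multi_edge colG _ bip).
  split=> [|f g /set1P-> /set1P->//].
  by apply/set0Pn; exists e; rewrite inE.
(* The bound [1 <= (k + 1) %/ 2] requires [k > 0], which the colour of [e] witnesses. *)
rewrite cards1; have /existsP[phi _] := colG.
by have := ltn_ord (phi e); lia.
Qed.
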